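(* Let $n\ge 2$ and let $A_n$ be the $n\times n$ Hessenberg-Toeplitz matrix with coefficients $a_{-1},a_0,\dots,a_{n-1}$, where $a_{-1}\neq 0$. Let $x=(x_{n-1},x_{n-2},\ldots,x_0)^{\top}$ be an eigenvector of $A_n$ associated to an eigenvalue $\lambda$. Then for all $i=1,\ldots,n-1$, $$x_i=\left(\frac{-1}{a_{-1}}\right)^{i} d_i(\lambda)\,x_0,$$ where $d_i(\lambda)$ is the characteristic polynomial of $A_i$.
   Context: For scalars (complex numbers) $a_{-1},a_0,a_1,\dots$, the (upper) Hessenberg-Toeplitz matrix $A_m$ is the $m\times m$ matrix whose $(p,q)$ entry is $a_{q-p}$ if $q-p\ge -1$ and $0$ otherwise, that is $$A_{m} = \begin{pmatrix} a_{0} & a_{1} & a_{2} & \cdots & a_{m-1} \\ a_{-1} & a_{0} & a_{1} & \cdots & a_{m-2} \\ 0 & a_{-1} & a_{0} & \cdots & a_{m-3} \\ \vdots & \vdots & \vdots & \ddots & \vdots \\ 0 & 0 & 0 & \cdots & a_{0} \end{pmatrix}.$$ The matrices $A_i$, $i\le n$, use the same coefficients. The characteristic polynomial of an $m\times m$ matrix $A_m$ is $\det(A_m-\lambda I)$. Note that the entries of $x$ are indexed in decreasing order, so $x_0$ is the last entry. *)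

(* Defs.v *)
From HB Require Import structures.
From mathcomp Require Import all_boot all_order all_algebra.
From mathcomp Require Import reals complex.

Set Implicit Arguments.
Unset Strict Implicit.
Unset Printing Implicit Defensive.

Import Order.TTheory GRing.Theory Num.Theory.
Local Open Scope ring_scope.

Definition hessenberg_toeplitz (F : comNzRingType) (a : int -> F) (m : nat) :
    'M[F]_m :=
  \matrix_(p < m, q < m)
    if -1 <= (q : nat)%:Z - (p : nat)%:Z
    then a ((q : nat)%:Z - (p : nat)%:Z) else 0.

(* The sign convention is det (A - X I), so this is (-1) ^+ m times the monic
   [char_poly A] of mxpoly. *)
Definition characteristic_poly (F : comNzRingType) (m : nat) (A : 'M[F]_m) :
    {poly F} :=
  \det (map_mx polyC A - 'X%:M).

(* [eigenvalue] and [eigenspace] of mxalgebra act on row vectors; here the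
   eigenvectors are column vectors. *)
Definition is_eigenvector (F : comNzRingType) (m : nat) (A : 'M[F]_m)
    (lambda : F) (x : 'cV[F]_m) : Prop :=
  x != 0 /\ A *m x = lambda *: x.

(* The column vector (x_{m-1}, ..., x_1, x_0)^T. *)
Definition decreasing_col (F : comNzRingType) (m : nat) (x : nat -> F) :
    'cV[F]_m :=
  \col_(j < m) x (m - 1 - j)%N.

(* Main.v *)
(** In the last [i] equations of [(A_n - lambda I) x = 0] only
    [x_i, ..., x_0] occur.  Adding the tautological equation [x_0 = x_0] on top
    gives a square system [N v = x_0 e_0] with [v = (x_i, ..., x_0)].  Here
    [det N = (- a_{-1}) ^ i] and the top left cofactor of [N] is [d_i(lambda)],
    so that Cramer's rule for the first unknown is the claim. *)

Require Import Defs.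
From HB Require Import structures.
From mathcomp Require Import all_boot all_order all_algebra.
From mathcomp Require Import reals complex.
From mathcomp Require Import zify.

Set Implicit Arguments.
Unset Strict Implicit.
Unset Printing Implicit Defensive.

Import Order.TTheory GRing.Theory Num.Theory.
Local Open Scope ring_scope.

Lemma horner_characteristic_poly (F : comNzRingType) (m : nat) (A : 'M[F]_m)
    (c : F) :
  (characteristic_poly A).[c] = \det (A - c%:M).
Proof.
rewrite /characteristic_poly -horner_evalE -det_map_mx; congr (\det _).
by apply/matrixP=> p q; rewrite !mxE /= horner_evalE hornerD hornerN hornerMn
  hornerC hornerX.
Qed.

(** Subtracting [c] times the identity changes only the coefficient at index 0, so eigenvectors
    become kernel vectors of a matrix of the same Hessenberg-Toeplitz shape. *)
Definition shift_coef (F : comNzRingType) (a : int -> F) (c : F) (k : int) : F :=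
  a k - c *+ (k == 0).

Lemma hessenberg_toeplitz_shift (F : comNzRingType) (a : int -> F) (m : nat)
    (c : F) :
  hessenberg_toeplitz a m - c%:M = hessenberg_toeplitz (shift_coef a c) m.
Proof.
apply/matrixP=> p q; rewrite !mxE /shift_coef.
have -> : ((q : nat)%:Z - (p : nat)%:Z == 0) = (p == q).
  by rewrite subr_eq0 eqz_nat eq_sym.
case: (eqVneq p q) => [->|_]; first by rewrite subrr.
by rewrite !mulr0n !subr0.
Qed.

(** The matrix [N]. Its top row selects the last entry of a column because [x 0] is stored last. *)
Definition bordered_hessenberg (F : comNzRingType) (b : int -> F) (i : nat) :
    'M[F]_i.+1 :=
  \matrix_(p, q) if p == ord0 then (q == ord_max)%:R
                 else hessenberg_toeplitz b i.+1 p q.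

(** Deleting row 0 and column 0 lowers both indices by one and so preserves [q - p]. *)
Lemma cofactor_bordered_hessenberg (F : comNzRingType) (b : int -> F) (i : nat) :
  cofactor (bordered_hessenberg b i) ord0 ord0
    = \det (hessenberg_toeplitz b i).
Proof.
rewrite /cofactor addn0 expr0 mul1r; congr (\det _).
apply/matrixP=> p q; rewrite !mxE eq_sym (negbTE (neq_lift _ _)) !lift0.
by have -> : q.+1%:Z - p.+1%:Z = (q : nat)%:Z - (p : nat)%:Z by lia.
Qed.

(** The top row leaves a single minor, with cofactor sign [(-1) ^+ i]. Its diagonal is the
    subdiagonal of the Hessenberg matrix, and it is upper triangular. *)
Lemma det_bordered_hessenberg (F : comNzRingType) (b : int -> F) (i : nat) :
  \det (bordered_hessenberg b i) = (- b (-1)) ^+ i.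
Proof.
rewrite (expand_det_row _ ord0) (bigD1 ord_max) //= big1 => [|q qNmax]; last first.
  by rewrite mxE eqxx (negbTE qNmax) mul0r.
rewrite mxE !eqxx mul1r addr0 /cofactor add0n [RHS]exprNn; congr (_ * _).
(* [det_trig] concerns lower triangular matrices, hence the transpose. *)
rewrite -det_tr det_trig.
  rewrite -[i in RHS]card_ord -prodr_const; apply: eq_bigr => p _.
  rewrite !mxE eq_sym (negbTE (neq_lift _ _)) lift0 lift_max.
  by have -> : (p : nat)%:Z - p.+1%:Z = -1 by lia.
apply/is_trig_mxP=> p q /= lt_pq.
rewrite !mxE eq_sym (negbTE (neq_lift _ _)) lift0 lift_max.
by rewrite ifF //; apply/negbTE; lia.
Qed.

Lemma bordered_hessenberg_mul (F : comNzRingType) (b : int -> F) (m i : nat)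
    (x : nat -> F) :
  hessenberg_toeplitz b (m + i.+1) *m decreasing_col (m + i.+1) x = 0 ->
  bordered_hessenberg b i *m decreasing_col i.+1 x = x 0%N *: delta_mx ord0 ord0.
Proof.
move=> Hx0; apply/matrixP=> p j; rewrite [j]ord1 !mxE eqxx andbT.
case: (eqVneq p ord0) => [->|p_neq0].
  rewrite mulr1 (bigD1 ord_max) //= big1 => [|q qNmax].
    by rewrite !mxE !eqxx mul1r addr0 /= subn1 subnn.
  by rewrite !mxE eqxx (negbTE qNmax) mul0r.
have p_gt0 : (0 < p)%N by rewrite lt0n; apply: contra_neq p_neq0 => ?; apply: val_inj.
rewrite mulr0.
(* Row [p] of [N] is the tail of row [m + p] of the large matrix. As [p >= 1], the first [m] columns
   of that row lie strictly below the subdiagonal and vanish. *)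
have /matrixP/(_ (rshift m p) ord0) := Hx0; rewrite !mxE big_split_ord /=.
rewrite big1 ?add0r => [row_p|q _]; last first.
  rewrite !mxE /= ifF ?mul0r //; apply/negbTE; have := ltn_ord q; lia.
rewrite -[RHS]row_p; apply: eq_bigr => q _; rewrite !mxE (negbTE p_neq0) /=.
have -> : (m + q)%N%:Z - (m + p)%N%:Z = (q : nat)%:Z - (p : nat)%:Z by lia.
by have -> : (m + i.+1 - 1 - (m + q) = i.+1 - 1 - q)%N by lia.
Qed.

(** Cramer's rule in division-free form: multiply [N v = x_0 e_0] by the adjugate of [N] and read
    off the first entry. *)
Lemma hessenberg_toeplitz_kernel (F : comNzRingType) (b : int -> F) (n i : nat)
    (x : nat -> F) :
  (i < n)%N -> hessenberg_toeplitz b n *m decreasing_col n x = 0 ->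
  (- b (-1)) ^+ i * x i = \det (hessenberg_toeplitz b i) * x 0%N.
Proof.
move=> lt_in; rewrite -(subnK lt_in) => /bordered_hessenberg_mul Nv.
have := congr1 (mulmx (\adj (bordered_hessenberg b i))) Nv.
rewrite mulmxA mul_adj_mx mul_scalar_mx -scalemxAr.
move=> /matrixP/(_ ord0 ord0); rewrite -colE !mxE det_bordered_hessenberg.
by rewrite cofactor_bordered_hessenberg subn1 subn0 mulrC => ->; rewrite mulrC.
Qed.

Theorem theorem4 (R : realType) (n : nat) (hn : (2 <= n)%N)
    (a : int -> R[i]) (ha : a (-1) != 0)
    (lambda : R[i]) (x : nat -> R[i])
    (hx : is_eigenvector (hessenberg_toeplitz a n) lambda
            (decreasing_col n x)) :
  forall i : nat, (1 <= i <= n - 1)%N ->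
    x i = (-1 / a (-1)) ^+ i
          * (characteristic_poly (hessenberg_toeplitz a i)).[lambda]
          * x 0%N.
Proof.
move=> i i_bounds; have lt_in : (i < n)%N by lia.
have [_ Ax] := hx.
have kerx : hessenberg_toeplitz (shift_coef a lambda) n *m decreasing_col n x = 0.
  by rewrite -hessenberg_toeplitz_shift mulmxBl Ax mul_scalar_mx subrr.
have := hessenberg_toeplitz_kernel lt_in kerx.
rewrite horner_characteristic_poly hessenberg_toeplitz_shift -mulrA => <-.
(* The shift by [lambda] leaves the coefficient at -1 equal to [a (-1)], so the two [i]-th powers
   are inverse to each other. *)
rewrite /shift_coef mulr0n subr0 mulrA -exprMn.
by rewrite mulN1r mulrNN mulVf // expr1n mul1r.
Qed.
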